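(* Let $q\in\mathbb C$ with $0<|q|<1$, let $z\in\mathbb C$, and let $m\in\mathbb C$ be such that $q^{m+1+i}\neq 1$ for all integers $i\ge 0$. For all $t\in\mathbb C$ small enough (that is, for all $t$ with $|t|<\delta$ for some $\delta>0$), $$\sum_{n=0}^\infty \mathscr B^m_n(z;q)\,t^n=\frac{1}{1-t}\;{}_5\phi_5\left(\begin{array}{c} -q,\ q^{1/2},\ -q^{1/2},\ q^{(z+m+1)/2},\ 0\\ q^{m+1},\ (qt)^{1/2},\ -(qt)^{1/2},\ qt^{1/2},\ -qt^{1/2}\end{array};q,t\right).$$
   Context: For $a\in\mathbb C$: $(a;q)_0=1$ and $(a;q)_n=(1-a)(1-aq)\cdots(1-aq^{n-1})$ for $n\ge 1$ (in particular $(0;q)_n=1$). Complex powers $q^a$ and square roots are principal values, $q^a=\exp(a\,\mathrm{Log}\,q)$. The basic hypergeometric series is $${}_r\phi_s\left(\begin{array}{c} a_1,\dots,a_r\\ b_1,\dots,b_s\end{array};q,x\right)=\sum_{k=0}^\infty\frac{(a_1;q)_k\cdots(a_r;q)_k}{(b_1;q)_k\cdots(b_s;q)_k}\left((-1)^kq^{k(k-1)/2}\right)^{1+s-r}\frac{x^k}{(q;q)_k},$$ where the $b_i$ are such that the denominators never vanish. For integers $n\ge 0$, the $q$-Pasternack polynomial is $$\mathscr B^m_n(z;q)={}_3\phi_2\left(\begin{array}{c} q^{-n},\ q^{n+1},\ q^{(1+z+m)/2}\\ q,\ q^{m+1}\end{array};q,q^n\right).$$ *)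

(* Defs.v *)
From mathcomp Require Import all_boot all_order all_algebra.
From mathcomp Require Import complex.
From mathcomp Require Import all_classical all_reals all_analysis.

Set Implicit Arguments.
Unset Strict Implicit.
Unset Printing Implicit Defensive.

Import Order.TTheory GRing.Theory Num.Theory.
Import numFieldNormedType.Exports.

Local Open Scope ring_scope.
Local Open Scope complex_scope.

Section PrincipalPower.
Variable R : realType.
Implicit Types z a : R[i].

Definition cexp z : R[i] := (expR (complex.Re z))%:C * (cos (complex.Im z) +i* sin (complex.Im z)).

(* Principal argument of z != 0, in ]-pi, pi] (acos takes values in [0, pi]). *)
Definition carg z : R :=
  let theta := acos (complex.Re z / Normc.normc z) in
  if 0 <= complex.Im z then theta else - theta.

Definition clog z : R[i] := ln (Normc.normc z) +i* carg z.

(* As for powR, 0 ^ a is 0 for a != 0, so that cpow z 2^-1 is the principal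
   square root for every z, including 0. *)
Definition cpow z a : R[i] :=
  if z == 0 then (a == 0)%:R else cexp (a * clog z).

End PrincipalPower.

Section Hypergeometric.
Variable K : numFieldType.
Implicit Types (a b : seq K) (q x : K).

Definition qpoch (c q : K) (n : nat) : K := \prod_(i < n) (1 - c * q ^+ i).

(* The exponent 1 + s - r is an integer, possibly negative. *)
Definition qhyper_term a b q x (k : nat) : K :=
  (\prod_(c <- a) qpoch c q k) / (\prod_(c <- b) qpoch c q k)
  * ((-1) ^+ k * q ^+ 'C(k, 2)) ^ (1 + (size b)%:Z - (size a)%:Z)
  * (x ^+ k / qpoch q q k).

Definition has_sum (u : nat -> K) (s : K) : Prop :=
  (series u @ \oo --> s)%classic.

Definition qhyper a b q x : K := limn (series (qhyper_term a b q x)).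

(* qhyper is total; this says that its value is meaningful: no denominator
   vanishes and the series converges. *)
Definition qhyper_defined a b q x : Prop :=
  (forall (c : K) (k : nat), c \in b -> qpoch c q k != 0) /\
  (forall k : nat, qpoch q q k != 0) /\
  has_sum (qhyper_term a b q x) (qhyper a b q x).

End Hypergeometric.

Definition qPasternack (R : realType) (m : R[i]) (n : nat) (z q : R[i]) : R[i] :=
  qhyper [:: q ^- n; q ^+ n.+1; cpow q ((1 + z + m) / 2)]
         [:: q; cpow q (m + 1)] q (q ^+ n).

(* Main.v *)
Require Import Defs.
From mathcomp Require Import all_boot all_order all_algebra.
From mathcomp Require Import complex ring.
From mathcomp Require Import all_classical all_reals all_analysis.

Set Implicit Arguments.
Unset Strict Implicit.
Unset Printing Implicit Defensive.

Import Order.TTheory GRing.Theory Num.Theory.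
Import numFieldNormedType.Exports.

Local Open Scope ring_scope.
Local Open Scope complex_scope.

(** Reversing the terminating product [(q^-n; q)_k] (lemma [qpoch_negX]) turns
    the polynomial into the double-series form
      [B_n = \sum_(k <= n) c_k (q; q)_(n+k) / (q; q)_(n-k)],
      [c_k = (-1)^k q^(k(k-1)/2) (A; q)_k / ((B; q)_k (q; q)_k ^2)],
    with [A = q^((z+m+1)/2)] and [B = q^(m+1)] (lemma [pasternack_qhyper]).
    Multiply by [t^n], sum over n first, and put [n = k + j]: the k-th column is
    [c_k (q; q)_2k t^k] times [\sum_j (q^(2k+1); q)_j / (q; q)_j t^j], which the
    q-binomial theorem evaluates to [1 / (t; q)_(2k+1)]. Splitting the products
    of length 2k along even and odd factors and then as differences of squares
    (lemma [qpoch_double]) identifies what is left with [1 / (1 - t)] times the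
    general term of the 5phi5 series (lemma [generating_qhyper_term]).

    The interchange of summations is made quantitative instead of being
    deduced from absolute summability. Both partial sums of order N are finite,
    and they differ by the remainders of N truncated q-binomial series. The
    Pascal rule gives a recursion for these remainders in which each step adds
    one boundary term (lemma [qbin_remS]), so all the quantities involved are
    at most geometric in k, with a common ratio [growth] depending only on q, A
    and B. For [|t| <= 1 / (4 growth)] the difference of the partial sums is at
    most [3 / 2^N] (lemma [pasternack_generating_partial]). The general term of
    the 5phi5 series is then dominated by a geometric one, and convergence
    follows from the completeness of the real line applied to real and imaginary
    parts (lemma [cvg_series_geometric]). *)

(** * Finite q-shifted factorials *)

Section QPochhammer.
Variables (K : numFieldType) (q : K).
Implicit Types c x : K.

Lemma qpoch0 c : qpoch c q 0 = 1.
Proof. by rewrite /qpoch big_ord0. Qed.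

Lemma qpochSr c n : qpoch c q n.+1 = qpoch c q n * (1 - c * q ^+ n).
Proof. by rewrite /qpoch big_ord_recr. Qed.

Lemma qpochS c n : qpoch c q n.+1 = (1 - c) * qpoch (c * q) q n.
Proof.
rewrite /qpoch big_ord_recl expr0 mulr1; congr (_ * _).
by apply: eq_bigr => i _; rewrite /= /bump /= add1n exprS mulrA.
Qed.

Lemma qpochD c m n :
  qpoch c q (m + n) = qpoch c q m * qpoch (c * q ^+ m) q n.
Proof.
elim: n => [|n IHn]; first by rewrite addn0 qpoch0 mulr1.
by rewrite addnS !qpochSr IHn -!mulrA -exprD.
Qed.

Lemma qpoch_param0 n : qpoch 0 q n = 1.
Proof. by rewrite /qpoch big1 // => i _; rewrite mul0r subr0. Qed.

Lemma qpoch_neq0 c n :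
  (forall i, 1 - c * q ^+ i != 0) -> qpoch c q n != 0.
Proof. by move=> h; apply/prodf_neq0 => i _; apply: h. Qed.

(** Grouping the even and the odd factors of the product of length 2k, and
    splitting each [1 - y ^+ 2] as a difference of squares. *)
Lemma qpoch_double x s r k : s ^+ 2 = x -> r ^+ 2 = x * q ->
  qpoch x q k.*2 = qpoch s q k * qpoch (- s) q k * qpoch r q k * qpoch (- r) q k.
Proof.
move=> hs hr; elim: k => [|k IHk]; first by rewrite !qpoch0 !mulr1.
rewrite doubleS !qpochSr IHk.
have -> : 1 - x * q ^+ k.*2 = (1 - s * q ^+ k) * (1 + s * q ^+ k).
  by rewrite -hs -mul2n mulnC exprM; ring.
have -> : 1 - x * q ^+ k.*2.+1 = (1 - r * q ^+ k) * (1 + r * q ^+ k).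
  by rewrite exprS mulrA -hr -mul2n mulnC exprM; ring.
by ring.
Qed.

(** Each factor [1 - q ^ (i - n)] is [- q ^ (i - n)] times a factor of
    [(q; q)_n]. *)
Lemma qpoch_negX n k : q != 0 -> (k <= n)%N ->
  qpoch (q ^- n) q k * (q ^+ n) ^+ k * qpoch q q (n - k) =
  (-1) ^+ k * q ^+ 'C(k, 2) * qpoch q q n.
Proof.
move=> q0; elim: k => [|k IHk] lkn.
  by rewrite qpoch0 bin0n !expr0 !mul1r subn0.
have qn0 : q ^+ n != 0 by rewrite expf_neq0.
have e : (n - k = (n - k.+1).+1)%N by rewrite subnSK.
move: (IHk (ltnW lkn)); rewrite e qpochSr qpochSr => IH.
rewrite binS bin1 exprD [(-1) ^+ k.+1]exprS [in LHS]exprS.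
have hq : (1 - q ^- n * q ^+ k) * q ^+ n = - q ^+ k * (1 - q * q ^+ (n - k.+1)).
  rewrite mulrBl mulrAC mulVf // mul1r mulNr mulrBr mulr1 -exprS -exprD.
  by rewrite -e subnKC ?(ltnW lkn) //; ring.
transitivity (qpoch (q ^- n) q k * (q ^+ n) ^+ k * qpoch q q (n - k.+1)
              * ((1 - q ^- n * q ^+ k) * q ^+ n)); first by ring.
rewrite hq.
transitivity (- q ^+ k * (qpoch (q ^- n) q k * (q ^+ n) ^+ k *
  (qpoch q q (n - k.+1) * (1 - q * q ^+ (n - k.+1))))); first by ring.
by rewrite IH; ring.
Qed.

Lemma qpoch_negX_eq0 n k : q != 0 -> (n < k)%N -> qpoch (q ^- n) q k = 0.
Proof.
move=> q0 nk; apply/eqP; rewrite /qpoch prodf_seq_eq0; apply/hasP.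
by exists (Ordinal nk); rewrite ?mem_index_enum //= mulVf ?subrr ?expf_neq0.
Qed.

Hypothesis q1 : `|q| < 1.

Lemma norm_qX_le1 n : `|q ^+ n| <= 1.
Proof. by rewrite normrX exprn_ile1 // ltW. Qed.

Lemma norm_1subqX_ge n : 1 - `|q| <= `|1 - q ^+ n.+1|.
Proof.
apply: le_trans (lerB_dist _ _); rewrite normr1 lerB // exprS normrM.
by rewrite ler_piMr // norm_qX_le1.
Qed.

Lemma oneSubqX_neq0 n : 1 - q ^+ n.+1 != 0.
Proof.
by rewrite -normr_gt0 (lt_le_trans _ (norm_1subqX_ge n)) // subr_gt0.
Qed.

Lemma qpochqq_neq0 n : qpoch q q n != 0.
Proof. by apply: qpoch_neq0 => i; rewrite -exprS oneSubqX_neq0. Qed.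

Lemma qpoch_norm_le c n : `|qpoch c q n| <= (1 + `|c|) ^+ n.
Proof.
rewrite /qpoch normr_prod -[in leRHS](card_ord n) -prodr_const.
apply: ler_prod => i _; rewrite normr_ge0 /=.
rewrite (le_trans (ler_normB _ _)) // normr1 lerD2l normrM.
by rewrite ler_piMr // norm_qX_le1.
Qed.

Lemma qpoch_normV_le c C n : (forall i, `|(1 - c * q ^+ i)^-1| <= C) ->
  `|(qpoch c q n)^-1| <= C ^+ n.
Proof.
move=> hC; rewrite /qpoch -prodfV normr_prod -[in leRHS](card_ord n) -prodr_const.
by apply: ler_prod => i _; rewrite normr_ge0 /=.
Qed.

Lemma qpochqq_normV_le n : `|(qpoch q q n)^-1| <= (1 - `|q|)^-1 ^+ n.
Proof.
apply: qpoch_normV_le => i; rewrite -exprS normfV lef_pV2 ?norm_1subqX_ge //.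
  by rewrite posrE normr_gt0 oneSubqX_neq0.
by rewrite posrE subr_gt0.
Qed.

End QPochhammer.

(** * The truncated q-binomial theorem *)

Section QBinomial.
Variables (K : numFieldType) (q : K).

(** The Gaussian binomial coefficient [a + j - 1] choose [j]: the coefficient of
    [t^j] in [1 / (t; q)_a]. *)
Definition qbinc (a j : nat) : K := qpoch (q ^+ a) q j / qpoch q q j.

Hypothesis q1 : `|q| < 1.

Lemma qbincS a j : qbinc a.+1 j.+1 = qbinc a j.+1 + q ^+ a * qbinc a.+1 j.
Proof.
rewrite /qbinc [qpoch (q ^+ a.+1) q j.+1]qpochSr [qpoch (q ^+ a) q j.+1]qpochS.
rewrite [qpoch q q j.+1]qpochSr -exprS -exprSr.
have h1 := qpochqq_neq0 q1 j; have h2 := oneSubqX_neq0 q1 j.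
have -> : q ^+ a.+1 * q ^+ j = q ^+ a * q ^+ j.+1 by rewrite -!exprD addSnnS.
by field; rewrite h1 h2.
Qed.

Lemma qbinc0n j : qbinc 0 j.+1 = 0.
Proof. by rewrite /qbinc expr0 qpochS subrr !mul0r. Qed.

Lemma qbincn0 a : qbinc a 0 = 1.
Proof. by rewrite /qbinc !qpoch0 divr1. Qed.

Lemma qbinc_norm_le a j : `|qbinc a j| <= (2 / (1 - `|q|)) ^+ j.
Proof.
rewrite exprMn normrM ler_pM ?normr_ge0 ?qpochqq_normV_le //.
apply: le_trans (qpoch_norm_le q1 _ _) _.
rewrite lerXn2r ?nnegrE ?addr_ge0 ?ler01 ?ler0n //.
by rewrite (_ : 2 = 1 + 1 :> K) // lerD2l norm_qX_le1.
Qed.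

Lemma norm_1subtqX_ge t i : `|t| <= 2^-1 -> 2^-1 <= `|1 - t * q ^+ i|.
Proof.
move=> ht; apply: le_trans (lerB_dist _ _); rewrite normr1 normrM.
have h : `|t| * `|q ^+ i| <= 2^-1.
  by apply: le_trans ht; rewrite ler_piMr // norm_qX_le1.
have e : 2^-1 = 1 - 2^-1 :> K by field.
by rewrite {1}e lerB.
Qed.

Lemma oneSubtqX_neq0 t i : `|t| <= 2^-1 -> 1 - t * q ^+ i != 0.
Proof.
move=> ht; by rewrite -normr_gt0 (lt_le_trans _ (norm_1subtqX_ge i ht)).
Qed.

Lemma oneSubtqX_normV_le t i : `|t| <= 2^-1 -> `|(1 - t * q ^+ i)^-1| <= 2.
Proof.
move=> ht; rewrite normfV -[leRHS]invrK lef_pV2 ?norm_1subtqX_ge //.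
  by rewrite posrE normr_gt0 oneSubtqX_neq0.
by rewrite posrE invr_gt0 ltr0n.
Qed.

Definition qbin_rem t a M : K :=
  (qpoch t q a)^-1 - \sum_(j < M) qbinc a j * t ^+ j.

(** The Pascal rule is the coefficientwise form of the functional equation
    [(1 - t q^a) / (t; q)_(a+1) = 1 / (t; q)_a]; truncating it after M + 1
    terms leaves a single boundary term. *)
Lemma qbin_remS t a M : `|t| <= 2^-1 ->
  (1 - t * q ^+ a) * qbin_rem t a.+1 M.+1 =
  qbin_rem t a M.+1 + q ^+ a * qbinc a.+1 M * t ^+ M.+1.
Proof.
move=> ht; rewrite /qbin_rem mulrBr qpochSr invfM.
rewrite [(1 - _) * (_ * _)]mulrCA divff ?oneSubtqX_neq0 // mulr1.
rewrite -addrA; congr (_ + _).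
elim: M => [|M IHM].
  by rewrite !big_ord_recr !big_ord0 /= !add0r !qbincn0 expr0 expr1; ring.
by rewrite big_ord_recr [in RHS]big_ord_recr /= mulrDr opprD IHM qbincS !exprS; ring.
Qed.

(** The remainder of the q-binomial series is controlled geometrically in both
    indices; the bound is crude in [a], which costs only a smaller disc in [t].
    The subtracted 1 makes the induction close. *)
Lemma qbin_rem_norm_le t a M : `|t| <= 2^-1 ->
  `|qbin_rem t a M.+1| <= 3 ^+ a * (2 / (1 - `|q|) * `|t|) ^+ M.+1.
Proof.
move=> ht; set y := (_ * `|t|) ^+ _.
have hL0 : 0 <= 2 / (1 - `|q|) :> K by rewrite divr_ge0 ?ler0n // subr_ge0 ltW.
have y0 : 0 <= y by rewrite exprn_ge0 // mulr_ge0.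
suff h : `|qbin_rem t a M.+1| <= (3 ^+ a - 1) * y.
  by apply: le_trans h _; rewrite ler_wpM2r // gerBl.
elim: a => [|a IHa].
  rewrite expr0 subrr mul0r /qbin_rem qpoch0 invr1 big_ord_recl qbincn0 big1.
    by rewrite addr0 mul1r expr0 subrr normr0.
  by move=> i _; rewrite /= /bump /= add1n qbinc0n mul0r.
have -> : qbin_rem t a.+1 M.+1 = (1 - t * q ^+ a)^-1 *
    (qbin_rem t a M.+1 + q ^+ a * qbinc a.+1 M * t ^+ M.+1).
  by rewrite -qbin_remS // mulKf // oneSubtqX_neq0.
have hb : `|q ^+ a * qbinc a.+1 M * t ^+ M.+1| <= y.
  rewrite /y [leRHS]exprMn normrM normrX ler_wpM2r ?exprn_ge0 //.
  rewrite normrM [leRHS]exprS ler_pM ?normr_ge0 ?qbinc_norm_le //.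
  apply: le_trans (norm_qX_le1 q1 a) _.
  rewrite ler_pdivlMr ?subr_gt0 // mul1r; apply: le_trans (_ : 1 <= _).
    by rewrite gerBl.
  by rewrite ler1n.
rewrite normrM; apply: le_trans (_ : 2 * ((3 ^+ a - 1) * y + y) <= _).
  rewrite ler_pM ?normr_ge0 ?oneSubtqX_normV_le //.
  by apply: le_trans (ler_normD _ _) _; rewrite lerD.
rewrite -{2}[y]mul1r -mulrDl addrNK mulrA ler_wpM2r //.
have -> : 3 ^+ a.+1 - 1 = 2 * 3 ^+ a + (3 ^+ a - 1) :> K by rewrite exprS; ring.
by rewrite lerDl subr_ge0 exprn_ege1 // ler1n.
Qed.

End QBinomial.

(** * Generating function over an arbitrary field with a norm *)

Lemma sum_triangle (V : zmodType) (F : nat -> nat -> V) N :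
  \sum_(n < N) \sum_(k < n.+1) F n k = \sum_(k < N) \sum_(j < N - k) F (k + j)%N k.
Proof.
elim: N => [|N IHN]; first by rewrite !big_ord0.
rewrite big_ord_recr IHN /= [in RHS]big_ord_recr /= subSnn big_ord1 addn0.
rewrite [in LHS]big_ord_recr /= addrA; congr (_ + _).
rewrite -big_split /=; apply: eq_bigr => k _.
by rewrite subSn ?(ltnW (ltn_ord k)) // big_ord_recr /= subnKC // ltnW.
Qed.

Section GeneratingFunction.
Variables (K : numFieldType) (q A B C : K).

Definition pasternack_weight k : K :=
  (-1) ^+ k * q ^+ 'C(k, 2) * qpoch A q k / (qpoch B q k * qpoch q q k ^+ 2).

(** The polynomial itself, once its negative powers of q are cleared: see
    [pasternack_qhyper]. *)
Definition pasternack_sum n : K :=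
  \sum_(k < n.+1) pasternack_weight k * (qpoch q q (n + k) / qpoch q q (n - k)).

(** The k-th term of the right-hand side, the factor [1 / (1 - t)] included:
    see [generating_qhyper_term]. *)
Definition generating_term t k : K :=
  pasternack_weight k * qpoch q q k.*2 * t ^+ k / qpoch t q k.*2.+1.

(** The ratio of a geometric majorant, [C] bounding the inverses of the factors of
    [(B; q)_k]. The first summand controls [c_k (q; q)_2k 9^k], with
    [36 = 2^2 * 9]; the second one controls the q-binomial coefficients. *)
Definition growth : K :=
  36 * (1 + `|A|) * C * (1 - `|q|)^-1 ^+ 2 + 2 / (1 - `|q|).

Hypothesis q1 : `|q| < 1.
Hypothesis hC : forall i, `|(1 - B * q ^+ i)^-1| <= C.

Let C0 : 0 <= C. Proof. by apply: le_trans (hC 0%N). Qed.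

Let iq0 : 0 <= (1 - `|q|)^-1. Proof. by rewrite invr_ge0 subr_ge0 ltW. Qed.

Let growth_ge_first : 36 * (1 + `|A|) * C * (1 - `|q|)^-1 ^+ 2 <= growth.
Proof. by rewrite lerDl mulr_ge0 ?ler0n. Qed.

Let growth_ge_second : 2 / (1 - `|q|) <= growth.
Proof.
by rewrite lerDr !mulr_ge0 ?exprn_ge0 // ?ler0n // addr_ge0.
Qed.

Lemma growth_ge2 : 2 <= growth.
Proof.
apply: le_trans growth_ge_second; rewrite ler_peMr ?ler0n //.
by rewrite invf_ge1 ?subr_gt0 // gerBl.
Qed.

Let growth_ge0 : 0 <= growth.
Proof. by apply: le_trans growth_ge2; rewrite ler0n. Qed.

(** The factor [9^k] pays for the [3^a] of [qbin_rem_norm_le] at [a = 2k + 1]. *)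
Lemma pasternack_weight_norm_le k :
  `|pasternack_weight k * qpoch q q k.*2| * 9 ^+ k <= growth ^+ k.
Proof.
apply: le_trans (_ : (36 * (1 + `|A|) * C * (1 - `|q|)^-1 ^+ 2) ^+ k <= _); last first.
  by rewrite lerXn2r ?nnegrE // !mulr_ge0 ?exprn_ge0 ?ler0n // addr_ge0.
have -> : (36 * (1 + `|A|) * C * (1 - `|q|)^-1 ^+ 2) ^+ k =
   (((1 + `|A|) ^+ k * (C ^+ k * ((1 - `|q|)^-1 ^+ k) ^+ 2)) * 2 ^+ k.*2) * 9 ^+ k.
  rewrite -mul2n exprM [(_ ^+ k) ^+ 2]exprAC -!exprMn; congr (_ ^+ k).
  by ring.
rewrite ler_wpM2r ?exprn_ge0 ?ler0n // normrM.
apply: ler_pM; rewrite ?normr_ge0 //; last first.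
  apply: le_trans (qpoch_norm_le q1 _ _) _.
  rewrite lerXn2r ?nnegrE ?addr_ge0 ?ler01 ?ler0n //.
  by rewrite (_ : 2 = 1 + 1 :> K) // lerD2l ltW.
rewrite /pasternack_weight normrM; apply: ler_pM; rewrite ?normr_ge0 //.
  rewrite !normrM normrX normrN1 expr1n mul1r -[leRHS]mul1r.
  by rewrite ler_pM ?normr_ge0 ?norm_qX_le1 ?qpoch_norm_le.
rewrite invfM normrM; apply: ler_pM; rewrite ?normr_ge0 //.
  exact: qpoch_normV_le.
rewrite -exprVn normrX lerXn2r ?nnegrE ?exprn_ge0 ?normr_ge0 //.
exact: qpochqq_normV_le.
Qed.

Variable t : K.
Hypothesis ht : growth * `|t| <= 4^-1.

Lemma small_t : `|t| <= 2^-1.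
Proof.
have h4 : 4^-1 = 2^-1 * 2^-1 :> K by field.
have h : 2 * `|t| <= 4^-1 by apply: le_trans ht; rewrite ler_wpM2r // growth_ge2.
apply: le_trans (_ : 4^-1 <= _).
  by apply: le_trans h; rewrite ler_peMl // ler1n.
by rewrite h4 ler_piMl ?invf_le1 ?ler1n ?ltr0n // invr_ge0 ler0n.
Qed.

Lemma generating_term_norm_le k : `|generating_term t k| <= 2 * 4^-1 ^+ k.
Proof.
rewrite /generating_term normrM normrM [`|t ^+ k|]normrX.
have hw : `|pasternack_weight k * qpoch q q k.*2| * 4 ^+ k <= growth ^+ k.
  apply: le_trans (pasternack_weight_norm_le k).
  by rewrite ler_wpM2l // lerXn2r ?nnegrE ?ler0n // ler_nat.
have hd : `|(qpoch t q k.*2.+1)^-1| <= 2 * 4 ^+ k.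
  apply: le_trans (qpoch_normV_le _ (fun i => oneSubtqX_normV_le q1 i small_t)) _.
  by rewrite exprS -mul2n exprM (_ : 2 ^+ 2 = 4 :> K) //; ring.
apply: le_trans (ler_wpM2l _ hd) _; first by rewrite mulr_ge0 ?exprn_ge0.
apply: le_trans (_ : 2 * (growth * `|t|) ^+ k <= _).
  rewrite exprMn.
  have -> a b c : a * b * (2 * c) = 2 * ((a * c) * b) :> K by ring.
  by rewrite ler_wpM2l ?ler0n // ler_wpM2r ?exprn_ge0.
by rewrite ler_wpM2l ?ler0n // lerXn2r ?nnegrE ?mulr_ge0 // invr_ge0 ler0n.
Qed.

Lemma pasternack_partial_sum N :
  \sum_(n < N) pasternack_sum n * t ^+ n = \sum_(k < N)
   pasternack_weight k * qpoch q q k.*2 * t ^+ k *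
   \sum_(j < N - k) qbinc q k.*2.+1 j * t ^+ j.
Proof.
pose F n k := pasternack_weight k * (qpoch q q (n + k) / qpoch q q (n - k)) * t ^+ n.
transitivity (\sum_(n < N) \sum_(k < n.+1) F n k).
  by apply: eq_bigr => n _; rewrite mulr_suml.
rewrite sum_triangle; apply: eq_bigr => k _; rewrite mulr_sumr.
apply: eq_bigr => j _; rewrite /F addnAC addnn addKn qpochD exprD -exprS /qbinc.
by ring.
Qed.

(** Summing first over n and using the q-binomial theorem turns each column
    into [generating_term]; only the truncation at N remains, and the k-th
    column contributes at most [3 * (growth * |t|) ^ N], whatever k. *)
Lemma pasternack_generating_partial N :
  `|\sum_(n < N) pasternack_sum n * t ^+ n - \sum_(k < N) generating_term t k|
  <= 3 * 2^-1 ^+ N.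
Proof.
rewrite pasternack_partial_sum -sumrB.
apply: le_trans (ler_norm_sum _ _ _) _.
apply: le_trans (_ : \sum_(k < N) 3 * (growth * `|t|) ^+ N <= _).
  apply: ler_sum => -[k kN] _ /=.
  have e : (N - k = (N - k.+1).+1)%N by rewrite subnSK.
  rewrite /generating_term -mulrBr normrM distrC normrM [`|t ^+ k|]normrX.
  have hr := qbin_rem_norm_le q1 k.*2.+1 (N - k.+1) small_t.
  rewrite -e in hr.
  have hr' : `|qbin_rem q t k.*2.+1 (N - k)| <=
             3 * 9 ^+ k * (growth * `|t|) ^+ (N - k).
    apply: le_trans hr _.
    rewrite exprS -mul2n exprM (_ : 3 ^+ 2 = 9 :> K); last by ring.
    rewrite ler_wpM2l ?mulr_ge0 ?exprn_ge0 ?ler0n //.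
    by rewrite lerXn2r ?nnegrE ?mulr_ge0 ?ler0n // ler_wpM2r.
  apply: le_trans (ler_wpM2l _ hr') _; first by rewrite mulr_ge0 ?exprn_ge0.
  rewrite -{2}(subnKC (ltnW kN)) exprD [(growth * `|t|) ^+ k]exprMn.
  have -> a b c d : a * b * (3 * c * d) = 3 * ((a * c) * b * d) :> K by ring.
  rewrite ler_wpM2l ?ler0n // ler_wpM2r ?exprn_ge0 ?mulr_ge0 //.
  by rewrite ler_wpM2r ?exprn_ge0 // pasternack_weight_norm_le.
rewrite sumr_const card_ord -[leLHS]mulr_natr -[leLHS]mulrA ler_wpM2l ?ler0n //.
apply: le_trans (_ : 4^-1 ^+ N * N%:R <= _).
  by rewrite ler_wpM2r ?ler0n // lerXn2r ?nnegrE ?mulr_ge0 ?invr_ge0 ?ler0n.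
(* the number N of columns is absorbed by half of the decay *)
have -> : 4^-1 = 2^-1 * 2^-1 :> K by field.
rewrite exprMn -mulrA ler_piMr ?exprn_ge0 ?invr_ge0 ?ler0n //.
rewrite exprVn mulrC ler_pdivrMr ?mul1r -?natrX ?ler_nat ?ltr0n ?expn_gt0 //.
by rewrite ltnW // ltn_expl.
Qed.

End GeneratingFunction.

(** * Complex powers *)

Section PrincipalPower.
Variable R : realType.
Implicit Types z a b : R[i].

Lemma cexpD a b : cexp (a + b) = cexp a * cexp b.
Proof.
case: a b => [a1 a2] [b1 b2]; rewrite /cexp /= expRD cosD sinD.
by apply/eqP; rewrite eq_complex /=; apply/andP; split; apply/eqP; ring.
Qed.

(** On the upper half plane [sin (acos x) = sqrt (1 - x^2)] is the imaginary part
    over the modulus; the sign change of the argument on the lower half plane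
    restores the sign of the imaginary part. *)
Lemma cexp_clog z : z != 0 -> cexp (clog z) = z.
Proof.
case: z => x y z0; rewrite /cexp /clog /carg /=.
set r := Num.sqrt _; set s := acos _.
have hp : 0 < x ^+ 2 + y ^+ 2.
  rewrite lt_neqAle addr_ge0 ?sqr_ge0 // andbT eq_sym.
  by move: z0; rewrite eq_complex /= paddr_eq0 ?sqr_ge0 // !sqrf_eq0.
have r0 : 0 < r by rewrite sqrtr_gt0.
have r2 : r ^+ 2 = x ^+ 2 + y ^+ 2 by rewrite sqr_sqrtr // ltW.
have hx2 : (x / r) ^+ 2 = 1 - (y / r) ^+ 2.
  by rewrite !expr_div_n r2; field; rewrite gt_eqF.
have hb : -1 <= x / r <= 1.
  rewrite -ler_norml -(@expr_le1 _ 2) // real_normK ?num_real //.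
  by rewrite hx2 gerBl sqr_ge0.
have cs : cos s = x / r by rewrite acosK // in_itv.
have ss : sin s = `|y| / r.
  rewrite sin_acos // hx2 opprB addrCA subrr addr0 sqrtr_sqr normrM.
  by rewrite normfV (gtr0_norm r0).
have rn0 : r != 0 by rewrite gt_eqF.
rewrite lnK ?posrE //; apply/eqP; rewrite eq_complex /= !mul0r subr0 addr0.
case: ifPn => hy.
  by rewrite cs ss ger0_norm // !(mulrC r) !divfK ?eqxx.
rewrite -ltNge in hy.
by rewrite cosN sinN cs ss ltr0_norm // mulNr opprK !(mulrC r) !divfK ?eqxx.
Qed.

Lemma cpowD z a b : z != 0 -> cpow z (a + b) = cpow z a * cpow z b.
Proof. by move=> z0; rewrite /cpow (negPf z0) mulrDl cexpD. Qed.

Lemma cpow1 z : cpow z 1 = z.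
Proof.
rewrite /cpow; case: eqP => [->|/eqP z0]; first by rewrite oner_eq0.
by rewrite mul1r cexp_clog.
Qed.

Lemma cpow0 z : cpow z 0 = 1.
Proof.
rewrite /cpow eqxx; case: ifP => // _.
by rewrite mul0r /cexp /= expR0 cos0 sin0 mul1r.
Qed.

Lemma cpow_nat z (n : nat) : z != 0 -> cpow z n%:R = z ^+ n.
Proof.
move=> z0; elim: n => [|n IHn]; first by rewrite cpow0.
by rewrite -natr1 cpowD // IHn cpow1 exprSr.
Qed.

Lemma sqr_cpow_half z : cpow z 2^-1 ^+ 2 = z.
Proof.
have [->|z0] := eqVneq z 0.
  by rewrite /cpow eqxx invr_eq0 pnatr_eq0 expr0n.
rewrite expr2 -cpowD // (_ : 2^-1 + 2^-1 = 1) ?cpow1 //.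
by field.
Qed.

End PrincipalPower.

(** * Convergence of complex sequences and series *)

Lemma cvg_mul_of_diff (K : numFieldType) (u v : nat -> K) (c l : K) :
  (v @ \oo --> l -> (fun n => u n - c * v n) @ \oo --> 0 ->
   u @ \oo --> c * l)%classic.
Proof.
move=> vl d0; rewrite -[c * l]add0r.
have -> : u = fun n => (u n - c * v n) + c * v n.
  by apply/funext => n; rewrite subrK.
by apply: cvgD d0 _; apply: cvgMl_tmp.
Qed.

Section ComplexSeries.
Variable R : realType.
Local Open Scope classical_set_scope.
Local Notation C := (R[i] : numFieldType).

(** A positive complex number is real, so that neighbourhoods of 0 in the complex
    plane are tested on real radii. *)
Lemma cvg0_le_real (u : nat -> C) (v : nat -> R) :
  (forall n, `|u n| <= (v n)%:C) -> v @ \oo --> 0 -> u @ \oo --> (0 : C).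
Proof.
move=> uv v0; apply/cvgr0Pnorm_lt => -[a b]; rewrite ltcE /= => /andP[/eqP -> a0].
have /cvgr0Pnorm_lt /(_ _ a0) := v0.
apply: filterS => n hn; apply: le_lt_trans (uv n) _.
by rewrite ltcR; apply: le_lt_trans hn; apply: ler_norm.
Qed.

Lemma cvg_Re_Im (u : nat -> C) (a b : R) :
  (fun n => complex.Re (u n)) @ \oo --> a ->
  (fun n => complex.Im (u n)) @ \oo --> b -> u @ \oo --> (Complex a b : C).
Proof.
move=> ua ub; apply/cvgrPdist_lt => -[e f].
rewrite ltcE /= => /andP[/eqP -> e0].
have e20 : 0 < e / 2 by rewrite divr_gt0 // ltr0n.
have /cvgrPdist_lt /(_ _ e20) ha := ua.
have /cvgrPdist_lt /(_ _ e20) hb := ub.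
apply: filterS2 ha hb => n; case: (u n) => x y /= hx hy.
rewrite normc_def /= ltcR; apply: le_lt_trans (_ : `|a - x| + `|b - y| < _).
  rewrite -(@ler_pXn2r _ 2) ?nnegrE ?addr_ge0 ?sqrtr_ge0 //.
  rewrite sqr_sqrtr ?addr_ge0 ?sqr_ge0 // [leRHS]sqrrD.
  rewrite !real_normK ?num_real // addrAC lerDl.
  by rewrite mulrn_wge0 // mulr_ge0.
by rewrite [ltRHS](splitr e) ltrD.
Qed.

Lemma cvg_series_geometric (u : nat -> C) (c r : R) : 0 <= r < 1 ->
  (forall n, `|u n| <= (c * r ^+ n)%:C) -> cvgn (series u).
Proof.
move=> /andP[r0 r1] hu.
have hcv (f : nat -> R) : (forall n, `|f n| <= c * r ^+ n) -> cvgn (series f).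
  move=> hf; apply: normed_cvg.
  apply: (@series_le_cvg _ _ (geometric c r)) => //.
  - by move=> n; apply: normr_ge0.
  - by move=> n; apply: le_trans (hf n).
  - by apply: is_cvg_geometric_series; rewrite ger0_norm.
have hRe : cvgn (series (fun n => complex.Re (u n))).
  apply: hcv => n; rewrite -lecR; apply: le_trans (hu n); exact: normc_ge_Re.
have hIm : cvgn (series (fun n => complex.Im (u n))).
  apply: hcv => n; rewrite -lecR; apply: le_trans (hu n).
  case: (u n) => x y /=; rewrite normc_def /= lecR -sqrtr_sqr ler_wsqrtr //.
  by rewrite lerDr sqr_ge0.
have eRe n : complex.Re (series u n) = series (fun n => complex.Re (u n)) n.
  by rewrite /series /=; apply: big_morph => // -[? ?] [? ?].
have eIm n : complex.Im (series u n) = series (fun n => complex.Im (u n)) n.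
  by rewrite /series /=; apply: big_morph => // -[? ?] [? ?].
apply/cvg_ex; eexists; apply: cvg_Re_Im.
  under eq_fun do rewrite eRe.
  exact: hRe.
under eq_fun do rewrite eIm.
exact: hIm.
Qed.

End ComplexSeries.

(** * Identification of the hypergeometric series *)

Section HypergeometricForms.
Variables (K : numFieldType) (q A B : K).

Lemma qhyper_terminating (a b : seq K) (x : K) n :
  (forall k, (n < k)%N -> qhyper_term a b q x k = 0) ->
  qhyper a b q x = \sum_(k < n.+1) qhyper_term a b q x k.
Proof.
move=> h; rewrite /qhyper; apply: lim_near_cst => //.
exists n.+1 => // N /= nN.
rewrite /series /= (big_cat_nat (n := n.+1)) //= big_mkord.
rewrite [X in _ + X]big_nat_cond [X in _ + X]big1 ?addr0 //.
by move=> k /andP[/andP[nk _] _]; apply: h.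
Qed.

Hypothesis q0 : q != 0.
Hypothesis q1 : `|q| < 1.
Hypothesis hB : forall i, 1 - B * q ^+ i != 0.

(** The terms with [k > n] vanish since [(q^-n; q)_k] contains the factor
    [1 - q^-n q^n]; the others are rewritten by [qpoch_negX] and by
    [(q; q)_n (q^(n+1); q)_k = (q; q)_(n+k)]. *)
Lemma pasternack_qhyper n :
  qhyper [:: q ^- n; q ^+ n.+1; A] [:: q; B] q (q ^+ n) = pasternack_sum q A B n.
Proof.
rewrite (@qhyper_terminating _ _ _ n) => [|k nk]; last first.
  by rewrite /qhyper_term !big_cons qpoch_negX_eq0 // !mul0r.
apply: eq_bigr => -[k kn] _ /=.
rewrite /qhyper_term !big_cons !big_nil !mulr1.
rewrite /pasternack_weight.
have -> : qpoch q q (n + k) = qpoch q q n * qpoch (q ^+ n.+1) q k.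
  by rewrite qpochD -exprS.
have H := qpoch_negX q0 (kn : k <= n)%N.
have hk := qpochqq_neq0 q1 k; have hnk := qpochqq_neq0 q1 (n - k).
have hBk := qpoch_neq0 k hB.
transitivity (qpoch (q ^- n) q k * (q ^+ n) ^+ k * qpoch q q (n - k) *
  (qpoch (q ^+ n.+1) q k * qpoch A q k /
   (qpoch q q (n - k) * qpoch B q k * qpoch q q k ^+ 2))).
  by field; rewrite hk hBk hnk.
rewrite H; move: ((-1) ^+ k * _) => S.
by field; rewrite hk hBk hnk.
Qed.

(** The four square roots of the parameters pair up, by [qpoch_double], into
    [(q; q)_2k] in the numerator and [(q t; q)_2k] in the denominator. *)
Lemma generating_qhyper_term t s r u k :
  s ^+ 2 = q -> r ^+ 2 = q * t -> u ^+ 2 = t -> `|t| <= 2^-1 ->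
  qhyper_term [:: - q; s; - s; A; 0] [:: B; r; - r; q * u; - (q * u)] q t k =
  (1 - t) * generating_term q A B t k.
Proof.
move=> hs hr hu ht.
have hqk := qpochqq_neq0 q1 k; have hBk := qpoch_neq0 k hB.
have ht1 : 1 - t != 0 by have := oneSubtqX_neq0 q1 0 ht; rewrite expr0 mulr1.
have hd : qpoch (t * q) q k.*2 != 0.
  apply: qpoch_neq0 => i; rewrite -mulrA -exprS; exact: oneSubtqX_neq0.
rewrite /qhyper_term !big_cons !big_nil !mulr1.
rewrite (_ : _ - _ = 1 :> int) // expr1z qpoch_param0.
rewrite /generating_term /pasternack_weight qpochS.
rewrite (@qpoch_double _ _ q s q) //.
have e : qpoch (t * q) q k.*2 =
  qpoch r q k * qpoch (- r) q k * qpoch (q * u) q k * qpoch (- (q * u)) q k.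
  by apply: qpoch_double; [rewrite hr mulrC|rewrite exprMn hu; ring].
rewrite e in hd *; move: hd; rewrite !mulf_eq0 !negb_or.
move=> /andP[/andP[/andP[h1 h2] h3] h4].
by field; rewrite hqk hBk ht1 h1 h2 h3 h4.
Qed.

End HypergeometricForms.

Section ComplexParameters.
Variable R : realType.
Local Open Scope classical_set_scope.
Local Notation C := (R[i] : numFieldType).

(** Past some index N, [|B q^i| <= 1/2] bounds the inverse by 2; the finitely many
    earlier inverses are bounded by their sum. *)
Lemma bounded_inverse_factors (q B : C) : `|q| < 1 ->
  (forall i, 1 - B * q ^+ i != 0) ->
  exists D : C, forall i, `|(1 - B * q ^+ i)^-1| <= D.
Proof.
move=> q1 hB.
have q1' : `|Normc.normc q| < 1.
  by rewrite ger0_norm ?sqrtr_ge0 -?ltcR //; case: (q) => ? ?; rewrite sqrtr_ge0.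
have : (fun i => B * q ^+ i) @ \oo --> (0 : C).
  apply: (cvg0_le_real _ (cvg_geometric (Normc.normc B) q1')) => n.
  by rewrite normrM normrX rmorphM rmorphXn.
move/cvgr0Pnorm_le => /(_ 2^-1); rewrite invr_gt0 ltr0n => /(_ isT) [N _ hN].
exists (2 + \sum_(i < N) `|(1 - B * q ^+ i)^-1|) => i.
have [Ni|iN] := leqP N i.
  rewrite ler_wpDr ?sumr_ge0 // -(subnKC Ni) exprD mulrA.
  by apply: oneSubtqX_normV_le => //; apply: hN => /=.
rewrite (bigD1 (Ordinal iN)) //= addrCA ler_wpDr // addr_ge0 ?ler0n //.
exact: sumr_ge0.
Qed.

Lemma sqr_norm_lt1_oneSub_neq0 (q c x : C) i :
  `|q| < 1 -> c ^+ 2 = x -> `|x| < 1 -> 1 - c * q ^+ i != 0.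
Proof.
move=> q1 cx x1.
have c1 : `|c| < 1 by rewrite -(@expr_lt1 _ 2) // -normrX cx.
rewrite subr_eq0; apply: contraTneq c1 => /(congr1 Num.norm).
rewrite normr1 normrM => e.
by rewrite -real_leNgt ?normr_real ?real1 // e ler_piMr // norm_qX_le1.
Qed.

End ComplexParameters.

(** * The generating function *)

Theorem theorem3p4 (R : realType) (q z m : R[i])
    (q_gt0 : 0 < `|q|) (q_lt1 : `|q| < 1)
    (hm : forall i : nat, cpow q (m + 1 + i%:R) != 1) :
  exists2 delta : R, 0 < delta &
  forall t : R[i], `|t| < delta%:C ->
    let a := [:: - q; cpow q 2^-1; - cpow q 2^-1;
                 cpow q ((z + m + 1) / 2); 0] in
    let b := [:: cpow q (m + 1); cpow (q * t) 2^-1; - cpow (q * t) 2^-1;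
                 q * cpow t 2^-1; - (q * cpow t 2^-1)] in
    qhyper_defined a b q t /\
    has_sum (fun n : nat => qPasternack m n z q * t ^+ n)
            (1 / (1 - t) * qhyper a b q t).
Proof.
have q0 : q != 0 by rewrite -normr_gt0.
set B := cpow q (m + 1); set A := cpow q ((z + m + 1) / 2).
have hB i : 1 - B * q ^+ i != 0.
  by rewrite /B -cpow_nat // -cpowD // subr_eq0 eq_sym.
have [D hD] := bounded_inverse_factors q_lt1 hB.
pose E := growth q A D.
have E2 : 2 <= E := growth_ge2 A q_lt1 hD.
have E0 : 0 < E by apply: lt_le_trans E2; rewrite ltr0n.
have d0 : 0 < (4 * E)^-1 by rewrite invr_gt0 mulr_gt0 // ltr0n.
have dE : (complex.Re (4 * E)^-1)%:C = (4 * E)^-1 by rewrite RRe_real // gtr0_real.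
exists (complex.Re (4 * E)^-1); first by rewrite -ltcR dE.
move=> t; rewrite dE => ht a b.
have tE : E * `|t| <= 4^-1.
  rewrite mulrC -ler_pdivlMr //; apply: le_trans (ltW ht) _.
  by rewrite invfM.
have t2 : `|t| <= 2^-1 := small_t q_lt1 hD tE.
have t1 : `|t| < 1 by apply: le_lt_trans t2 _; rewrite invf_lt1 ?ltr1n ?ltr0n.
have qt1 : `|q * t| < 1.
  by rewrite normrM mulr_ilt1.
have ht1 : 1 - t != 0 by have := oneSubtqX_neq0 q_lt1 0 t2; rewrite expr0 mulr1.
have hser : series (qhyper_term a b q t) =
    fun N => (1 - t) * series (generating_term q A B t) N.
  apply/funext => N; rewrite /series /= mulr_sumr; apply: eq_bigr => k _.
  by apply: generating_qhyper_term => //; rewrite sqr_cpow_half.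
have hcv : cvgn (series (generating_term q A B t)).
  apply: (@cvg_series_geometric _ _ 2 4^-1).
    by rewrite invr_ge0 ler0n invf_lt1 ?ltr1n ?ltr0n.
  move=> k; apply: le_trans (generating_term_norm_le q_lt1 hD tE k) _.
  by rewrite rmorphM rmorphXn fmorphV !rmorph_nat.
have hsum : has_sum (qhyper_term a b q t) (qhyper a b q t).
  by rewrite /has_sum /qhyper hser; apply: is_cvgMl_tmp.
split.
  split; [|split => //].
    move=> c k; rewrite !inE => hc; apply: qpoch_neq0 => i.
    case/or4P: hc => [/eqP ->|/eqP ->|/eqP ->|]; first exact: hB.
    - exact: (sqr_norm_lt1_oneSub_neq0 i q_lt1 (sqr_cpow_half _) qt1).
    - apply: (sqr_norm_lt1_oneSub_neq0 i q_lt1 _ qt1).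
      by rewrite sqrrN sqr_cpow_half.
    have hu : (q * cpow t 2^-1) ^+ 2 = q * (q * t).
      by rewrite exprMn sqr_cpow_half expr2 mulrA.
    have hqqt : `|q * (q * t)| < 1 by rewrite normrM mulr_ilt1.
    case/orP => /eqP ->.
    + exact: (sqr_norm_lt1_oneSub_neq0 i q_lt1 hu hqqt).
    + by apply: (sqr_norm_lt1_oneSub_neq0 i q_lt1 _ hqqt); rewrite sqrrN.
  by move=> k; apply: qpochqq_neq0.
have hP n : qPasternack m n z q = pasternack_sum q A B n.
  rewrite -(pasternack_qhyper _ q0 q_lt1 hB) /qPasternack.
  by rewrite (_ : 1 + z + m = z + m + 1) // -addrA addrC.
(* the error [3 / 2^N] of the interchange of summations vanishes *)
have hdiff : ((fun N => series (fun n => qPasternack m n z q * t ^+ n) N -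
    series (generating_term q A B t) N) @ \oo --> (0 : (R[i] : numFieldType)))%classic.
  apply: (cvg0_le_real _ (@cvg_geometric _ 3 2^-1 _)) => [N|]; last first.
    by rewrite ger0_norm ?invr_ge0 ?ler0n // invf_lt1 ?ltr1n ?ltr0n.
  rewrite /series /= !big_mkord; under eq_bigr do rewrite hP.
  apply: le_trans (pasternack_generating_partial q_lt1 hD tE N) _.
  by rewrite rmorphM rmorphXn fmorphV !rmorph_nat.
apply: (cvg_mul_of_diff hsum).
suff -> : (fun N => series (fun n => qPasternack m n z q * t ^+ n) N -
    1 / (1 - t) * series (qhyper_term a b q t) N) =
  (fun N => series (fun n => qPasternack m n z q * t ^+ n) N -
     series (generating_term q A B t) N) by exact: hdiff.
by apply/funext => N; rewrite hser div1r mulKf.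
Qed.
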